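(* Let $\alpha>0$, let $D\ge 1$, and let $\mathcal{A}=\mathcal{A}^1\times\cdots\times\mathcal{A}^D$ be a product of finite nonempty sets, with actions written $\mathbf{a}=(a^1,\dots,a^D)$ and prefixes $\mathbf{a}^{-d}=(a^1,\dots,a^{d-1})$ (empty for $d=1$). Let $\mathcal{S}$ be the state space, let $A(\mathbf{s},\mathbf{a})=Q^*_{\mathrm{soft}}(\mathbf{s},\mathbf{a})-V^*_{\mathrm{soft}}(\mathbf{s})$ be the soft advantage, and let $\pi(\mathbf{a}\mid\mathbf{s})=\exp\left(\frac{1}{\alpha}A(\mathbf{s},\mathbf{a})\right)$ be the corresponding optimal maximum-entropy policy. For each $d\in\{1,\dots,D\}$ let $A^d(\mathbf{s},\mathbf{a}^{-d},a^d)\in\mathbb{R}$ be a dimensional soft advantage for $\pi$, i.e. for every $\mathbf{s}\in\mathcal{S}$ and every prefix $\mathbf{a}^{-d}\in\mathcal{A}^1\times\cdots\times\mathcal{A}^{d-1}$, $$\pi(a^d\mid \mathbf{s},\mathbf{a}^{-d})\;\propto\;\exp\left(\frac{1}{\alpha}A^d(\mathbf{s},\mathbf{a}^{-d},a^d)\right)\qquad\text{as a function of } a^d\in\mathcal{A}^d .$$ Suppose that for every $d\in\{1,\dots,D\}$, every $\mathbf{s}\in\mathcal{S}$ and every prefix $\mathbf{a}^{-d}$, $$\sum_{a^d\in\mathcal{A}^d}\exp\left(\frac{1}{\alpha}A^d(\mathbf{s},\mathbf{a}^{-d},a^d)\right)=1 .$$ Then for every $\mathbf{s}\in\mathcal{S}$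 and every $\mathbf{a}\in\mathcal{A}$, $$\sum_{d=1}^{D}A^d(\mathbf{s},\mathbf{a}^{-d},a^d)=A(\mathbf{s},\mathbf{a}).$$
   Context: The setting is maximum-entropy reinforcement learning (soft Q-learning) in a Markov decision process with state space $\mathcal{S}$, finite (discretized) action space $\mathcal{A}=\mathcal{A}^1\times\cdots\times\mathcal{A}^D$, discount factor $\gamma\in(0,1)$, transition dynamics $p(\mathbf{s}'\mid\mathbf{s},\mathbf{a})$, reward $r(\mathbf{s},\mathbf{a})$, and temperature $\alpha>0$. With $\pi^*$ the optimal policy for the entropy-regularized objective (expected sum of rewards plus $\alpha$ times the entropy $\mathcal{H}$ of the policy at the visited states), the real-valued optimal soft Q-function is $$Q^*_{\mathrm{soft}}(\mathbf{s}_t,\mathbf{a}_t)=r_t+\mathbb{E}\left[\sum_{l=1}^{\infty}\gamma^l\left(r_{t+l}+\alpha\,\mathcal{H}(\pi^*(\cdot\mid\mathbf{s}_{t+l}))\right)\right],$$ where the expectation is over future trajectories under $\pi^*$. The soft value function and soft advantage are $$V^*_{\mathrm{soft}}(\mathbf{s})=\alpha\log\sum_{\mathbf{a}'\in\mathcal{A}}\exp\left(\frac{1}{\alpha}Q^*_{\mathrm{soft}}(\mathbf{s},\mathbf{a}')\right),\qquad A(\mathbf{s},\mathbf{a})=Q^*_{\mathrm{soft}}(\mathbf{s},\mathbf{a})-V^*_{\mathrm{soft}}(\mathbf{s}).$$ It is a standard fact of soft Q-learning, taken as given, that the optimal policy is $\pi^*(\mathbf{a}\mid\mathbf{s})=\exp\left(\frac{1}{\alpha}A(\mathbf{s},\mathbf{a})\right)$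 and that $Q^*_{\mathrm{soft}}(\mathbf{s}_t,\mathbf{a}_t)=r_t+\gamma\,\mathbb{E}_{\mathbf{s}_{t+1}\sim p(\cdot\mid\mathbf{s}_t,\mathbf{a}_t)}[V^*_{\mathrm{soft}}(\mathbf{s}_{t+1})]$; the policy $\pi$ in the claim is this $\pi^*$. $\pi(a^d\mid\mathbf{s},\mathbf{a}^{-d})$ denotes the conditional probability, under the distribution $\pi(\cdot\mid\mathbf{s})$ on $\mathcal{A}$, that the $d$-th coordinate equals $a^d$ given that the first $d-1$ coordinates equal $\mathbf{a}^{-d}$ (for $d=1$, the marginal probability of the first coordinate). The symbol $\propto$ means equality up to a positive factor that may depend on $d,\mathbf{s},\mathbf{a}^{-d}$ but not on $a^d$. *)

(* Defs.v *)
From mathcomp Require Import all_boot all_order all_algebra.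
From mathcomp Require Import all_classical all_reals all_analysis.

Set Implicit Arguments.
Unset Strict Implicit.
Unset Printing Implicit Defensive.

Import Order.TTheory GRing.Theory Num.Theory.
Import numFieldNormedType.Exports.

Local Open Scope classical_set_scope.
Local Open Scope ring_scope.

(* Dimensions are 0-based: dimension [d : 'I_D] has prefix (a 0, ..., a (d-1)),
   which is the empty family for the first dimension. *)
Definition joint_action (D : nat) (Act : 'I_D -> finType) : finType :=
  {dffun forall d : 'I_D, Act d}.

Definition before (D : nat) (d : 'I_D) (i : 'I_d) : 'I_D :=
  widen_ord (ltnW (ltn_ord d)) i.

Definition action_prefix (D : nat) (Act : 'I_D -> finType) (d : 'I_D) : finType :=
  {dffun forall i : 'I_d, Act (before i)}.

Definition prefix_of (D : nat) (Act : 'I_D -> finType) (a : joint_action Act)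
    (d : 'I_D) : action_prefix Act d :=
  [ffun i : 'I_d => a (before i)].

(* Conditional probability of the [d]-th coordinate being [x] given that the
   earlier coordinates are [u], under the mass function [q]. *)
Definition cond_coord (R : realType) (D : nat) (Act : 'I_D -> finType)
    (q : joint_action Act -> R) (d : 'I_D) (u : action_prefix Act d)
    (x : Act d) : R :=
  (\sum_(a : joint_action Act | (prefix_of a d == u) && (a d == x)) q a) /
  (\sum_(a : joint_action Act | prefix_of a d == u) q a).

Section SoftMDP.
Context (R : realType) (dS : measure_display) (S : measurableType dS)
        (A : finType).

Record mdp := Mdp {
  trans : A -> R.-pker S ~> S;
  reward : S -> A -> R;
  reward_measurable : forall a, measurable_fun setT (fun s => reward s a);
  discount : R;
  discount_gt0 : 0 < discount;
  discount_lt1 : discount < 1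
}.

Record policy := Policy {
  pol :> S -> A -> R;
  pol_ge0 : forall s a, 0 <= pol s a;
  pol_sum1 : forall s, \sum_(a : A) pol s a = 1;
  pol_measurable : forall a, measurable_fun setT (fun s => pol s a)
}.

Definition entropy (q : A -> R) : R := - \sum_(a : A) q a * ln (q a).

Definition point_mass (a b : A) : R := (b == a)%:R.

Definition history (W : Type) (X : nat -> W -> S) (U : nat -> W -> A)
    (n : nat) (B : nat -> set S) (c : nat -> A) : set W :=
  [set w | forall i, (i <= n)%N -> B i (X i w) /\ U i w = c i].

(* A random state-action trajectory under [pi], started at the state [s] with
   first action distributed as [q0].  [law_step] prescribes the law of
   (state, action) number n+1 given the first n+1 pairs on measurable
   rectangles, which determines the law of the whole process. *)
Record trajectory (m : mdp) (pi : policy) (s : S) (q0 : A -> R) := Trajectory {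
  disp : measure_display;
  sample : measurableType disp;
  prob : probability sample R;
  st : nat -> sample -> S;
  act : nat -> sample -> A;
  st_measurable : forall n, measurable_fun setT (st n);
  act_measurable : forall n (c : A), measurable (act n @^-1` [set c]);
  law_init : forall (B : set S) (c : A), measurable B ->
    prob [set w | B (st 0 w) /\ act 0 w = c] = (\d_s B * (q0 c)%:E)%E;
  law_step : forall (n : nat) (B : nat -> set S) (c : nat -> A),
    (forall i, measurable (B i)) ->
    prob (history st act n.+1 B c) =
    (\int[prob]_(w in history st act n B c)
       \int[trans m (act n w) (st n w)]_(s' in B n.+1) (pi s' (c n.+1))%:E)%E
}.

Section Return.
Context (m : mdp) (alpha : R) (pi : policy) (s : S) (q0 : A -> R)
        (T : trajectory m pi s q0).

Definition soft_reward (l : nat) (w : sample T) : R :=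
  reward m (st l w) (act l w) + alpha * entropy (pi (st l w)).

Definition partial_return (k : nat) (w : sample T) (n : nat) : R :=
  \sum_(k <= l < n) discount m ^+ l * soft_reward l w.

Definition soft_return (k : nat) (w : sample T) : R :=
  limn (partial_return k w).

Definition return_converges (k : nat) : Prop :=
  {ae prob T, forall w, cvgn (partial_return k w)}.

Definition return_integrable (k : nat) : Prop :=
  return_converges k /\
  (prob T).-integrable setT (fun w => (soft_return k w)%:E).

Definition expected_return (k : nat) : \bar R := 'E_(prob T)[soft_return k].

End Return.

(* [pi] maximizes, from every initial state, the expected discounted sum of
   rewards plus [alpha] times the policy entropies. *)
Definition maxent_optimal (m : mdp) (alpha : R) (pi : policy) : Prop :=
  forall s : S, exists T : trajectory m pi s (pi s),
    return_integrable alpha T 0 /\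
    forall (pi' : policy) (T' : trajectory m pi' s (pi' s)),
      return_converges alpha T' 0 ->
      (expected_return alpha T' 0 <= expected_return alpha T 0)%E.

(* The entropy bonus starts at time 1: there is none at time 0, where the
   action is prescribed. *)
Definition soft_Q (m : mdp) (alpha : R) (pi : policy)
    (T : forall (s : S) (a : A), trajectory m pi s (point_mass a))
    (s : S) (a : A) : R :=
  reward m s a + fine (expected_return alpha (T s a) 1).

Definition soft_V (alpha : R) (Q : S -> A -> R) (s : S) : R :=
  alpha * ln (\sum_(a : A) expR (alpha^-1 * Q s a)).

Definition soft_advantage (alpha : R) (Q : S -> A -> R) (s : S) (a : A) : R :=
  Q s a - soft_V alpha Q s.

End SoftMDP.

(* [Adim d s u x] is a dimensional soft advantage for [pi]: the conditional law
   of coordinate [d] is proportional to [exp (Adim / alpha)], with a positive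
   factor independent of [x]. *)
Definition dim_soft_advantage (R : realType) (S : Type) (D : nat)
    (Act : 'I_D -> finType) (alpha : R) (pi : S -> joint_action Act -> R)
    (Adim : forall d : 'I_D, S -> action_prefix Act d -> Act d -> R) : Prop :=
  forall (d : 'I_D) (s : S) (u : action_prefix Act d),
    exists2 c : R, 0 < c &
      forall x : Act d, cond_coord (pi s) u x = c * expR (alpha^-1 * Adim d s u x).

(* Main.v *)
Require Import Defs.
From mathcomp Require Import all_boot all_order all_algebra.
From mathcomp Require Import all_classical all_reals all_analysis.

(** Normalization forces the proportionality constant between the conditional
    law of each coordinate and exp(A^d / alpha) to be 1, so exp(A^d / alpha) is
    that conditional law.  By the chain rule the product of the conditionals is
    pi(a | s) = exp(A / alpha); exp is injective. *)

Import Order.TTheory GRing.Theory Num.Theory.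

Local Open Scope ring_scope.

Section ConditionalLaw.
Context {R : realType} {D : nat} {Act : 'I_D -> finType}.
Implicit Types (q : joint_action Act -> R) (a b : joint_action Act) (d : 'I_D).

(** Prefixes of different lengths live in different types. Comparing joint actions with a fixed [a]
    puts all the conditioning events in one type, and [k] may also reach [D], where only [a]
    remains. *)
Definition agree_below a (k : nat) : pred (joint_action Act) :=
  fun b => [forall i : 'I_D, (i < k)%N ==> (b i == a i)].

Definition cylinder_mass q a (k : nat) : R := \sum_(b | agree_below a k b) q b.

Lemma prefix_of_eq a d b : (prefix_of b d == prefix_of a d) = agree_below a d b.
Proof.
apply/eqP/forallP => [eq_ba i|agr].
  apply/implyP => lt_id; move/ffunP: eq_ba => /(_ (Ordinal lt_id)).
  rewrite !ffunE.
  have -> : before (Ordinal lt_id) = i by apply: val_inj.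
  by move=> ->.
apply/ffunP => i; rewrite !ffunE; apply/eqP.
exact: (implyP (agr (before i)) (ltn_ord i)).
Qed.

Lemma agree_belowS a d b :
  agree_below a d.+1 b = agree_below a d b && (b d == a d).
Proof.
apply/forallP/andP => [agr|[/forallP agr eq_d] i].
  split; last exact: (implyP (agr d) (ltnSn d)).
  by apply/forallP => i; apply/implyP => /ltnW lt_id; exact: (implyP (agr i) lt_id).
apply/implyP; rewrite ltnS leq_eqVlt => /orP[/eqP/val_inj ->//|].
exact: (implyP (agr i)).
Qed.

Lemma cylinder_mass0 q a : cylinder_mass q a 0 = \sum_b q b.
Proof. by apply: eq_bigl => b; apply/forallP. Qed.

Lemma cylinder_mass_full q a : cylinder_mass q a D = q a.
Proof.
rewrite /cylinder_mass (big_pred1 a) // => b; apply/forallP/eqP => [agr|-> i].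
  by apply/ffunP => i; apply/eqP; exact: (implyP (agr i) (ltn_ord i)).
by rewrite eqxx implybT.
Qed.

Lemma cylinder_mass_gt0 q a k :
  (forall b, 0 <= q b) -> 0 < q a -> 0 < cylinder_mass q a k.
Proof.
move=> q_ge0 qa_gt0; rewrite /cylinder_mass (bigD1 a) /=.
  by rewrite ltr_wpDr // sumr_ge0.
by apply/forallP => i; rewrite eqxx implybT.
Qed.

(** Fixing coordinate [d] on top of the earlier ones is agreement below [d.+1]; this quotient of
    consecutive masses is what telescopes in the chain rule. *)
Lemma cond_coordE q a d :
  cond_coord q (prefix_of a d) (a d) = cylinder_mass q a d.+1 / cylinder_mass q a d.
Proof.
rewrite /cond_coord /cylinder_mass; congr (_ / _); apply: eq_bigl => b.
  by rewrite prefix_of_eq agree_belowS.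
exact: prefix_of_eq.
Qed.

(** The values of coordinate [d] partition the conditioning event. On an event of mass zero the
    quotients would all be 0, hence the hypothesis. *)
Lemma sum_cond_coord q d (u : action_prefix Act d) :
  \sum_(b | prefix_of b d == u) q b != 0 -> \sum_(x : Act d) cond_coord q u x = 1.
Proof.
move=> mass_neq0; rewrite /cond_coord -mulr_suml.
rewrite -(partition_big (fun b : joint_action Act => b d) xpredT) //.
exact: divff.
Qed.

(** Chain rule in logarithmic form: the sum telescopes from the total mass 1 at level 0 to [q a] at
    level [D]. Positivity of [q a] keeps every cylinder mass positive, so [ln] splits each
    quotient. *)
Lemma sum_ln_cond_coord q a :
  (forall b, 0 <= q b) -> \sum_b q b = 1 -> 0 < q a ->
  \sum_(d < D) ln (cond_coord q (prefix_of a d) (a d)) = ln (q a).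
Proof.
move=> q_ge0 q_sum1 qa_gt0.
have mass_gt0 k : 0 < cylinder_mass q a k by exact: cylinder_mass_gt0.
transitivity (\sum_(d < D) (ln (cylinder_mass q a d.+1) - ln (cylinder_mass q a d))).
  by apply: eq_bigr => d _; rewrite cond_coordE ln_div ?posrE.
rewrite -(big_mkord xpredT
  (fun k => ln (cylinder_mass q a k.+1) - ln (cylinder_mass q a k))).
rewrite telescope_sumr // cylinder_mass_full cylinder_mass0 q_sum1.
by rewrite ln1 subr0.
Qed.

End ConditionalLaw.

Theorem theorem4p3 (R : realType)
  (dS : measure_display) (S : measurableType dS)
  (D : nat) (hD : (0 < D)%N)
  (Act : 'I_D -> finType) (hAct : forall d : 'I_D, (0 < #|Act d|)%N)
  (m : mdp R S (joint_action Act))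
  (alpha : R) (halpha : 0 < alpha)
  (pi : policy R S (joint_action Act))
  (hopt : maxent_optimal m alpha pi)
  (T : forall (s : S) (a : joint_action Act), trajectory m pi s (point_mass R a))
  (hT : forall (s : S) (a : joint_action Act), return_integrable alpha (T s a) 1)
  (hpi : forall (s : S) (a : joint_action Act),
     pi s a = expR (alpha^-1 * soft_advantage alpha (soft_Q alpha T) s a))
  (Adim : forall d : 'I_D, S -> action_prefix Act d -> Act d -> R)
  (hAdim : dim_soft_advantage alpha pi Adim)
  (hnorm : forall (d : 'I_D) (s : S) (u : action_prefix Act d),
     \sum_(x : Act d) expR (alpha^-1 * Adim d s u x) = 1)
  (s : S) (a : joint_action Act) :
  \sum_(d < D) Adim d s (prefix_of a d) (a d)
    = soft_advantage alpha (soft_Q alpha T) s a.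
Proof.
have pi_gt0 b : 0 < pi s b by rewrite hpi expR_gt0.
have condE d :
    cond_coord (pi s) (prefix_of a d) (a d) =
    expR (alpha^-1 * Adim d s (prefix_of a d) (a d)).
  have [c _ cE] := hAdim d s (prefix_of a d).
  suff c1 : c = 1 by rewrite cE c1 mul1r.
  (* Writing [c] as [c] times the normalized sum turns it into the total conditional probability. *)
  rewrite -[c]mulr1 -[in LHS](hnorm d s (prefix_of a d)) mulr_sumr.
  under eq_bigr do rewrite -cE.
  (* The conditioning event contains [a], so its mass is positive. *)
  apply: sum_cond_coord; rewrite gt_eqF // (bigD1 a) //=.
  by rewrite ltr_wpDr // sumr_ge0 // => b _; exact: ltW.
(* After scaling by [alpha^-1], the right side is [ln (pi s a)] and each term on the left is the
   [ln] of a conditional probability. *)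
apply: (mulfI (lt0r_neq0 (eqbRL (invr_gt0 alpha) halpha))).
rewrite mulr_sumr -[RHS]expRK -hpi.
rewrite -(sum_ln_cond_coord (pi s) a (pol_ge0 pi s) (pol_sum1 pi s) (pi_gt0 a)).
by apply: eq_bigr => d _; rewrite condE expRK.
Qed.
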